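(* Let $k \geq 2$ be an integer. For any integer $0 \leq j \leq k-1$, $$B_{n}^{(j)} = \sum_{\substack{(a_1,\dots,a_k)\in\mathbb{Z}^k\\ n-k-j \,\leq\, a_1 + 2 a_2 + \dots + k a_k \,\leq\, n-k}} \left\langle (a_1, a_2, \dots, a_k) \right\rangle \quad \text{for all } n \in \mathbb{Z}.$$
   Context: Fix an integer $k \geq 2$. A two-sided sequence $\{F_n\}_{n\in\mathbb{Z}}$ is a Fibonacci sequence of order $k$ if $F_n = F_{n-1}+F_{n-2}+\dots+F_{n-k}$ for all $n\in\mathbb{Z}$; such a sequence is uniquely determined by its initial values $(F_0,\dots,F_{k-1})$. For $0\le j\le k-1$, $B^{(j)}=\{B^{(j)}_n\}_{n\in\mathbb{Z}}$ is the Fibonacci sequence of order $k$ with initial values $B^{(j)}_j=1$ and $B^{(j)}_n=0$ for $0\le n\le k-1$, $n\ne j$. Generalized binomial: for all integers $n,i$, $\left\langle \binom{n}{i}\right\rangle = \frac{n(n-1)(n-2)\cdots(i+1)}{(n-i)!}$ if $n\ge i$ (the empty product being $1$ when $n=i$), and $\left\langle \binom{n}{i}\right\rangle=0$ if $n<i$. Equivalently, $\left\langle \binom{n}{i}\right\rangle=\binom{n}{i}$ if $n\ge i\ge 0$, $\left\langle \binom{n}{i}\right\rangle=(-1)^{i+n}\binom{-i-1}{-n-1}$ if $-1\ge n\ge i$, and $0$ otherwise. Generalized multinomial: for an integer $t\ge2$ and any integers $i_1,\dots,i_t$, $$\left\langle (i_1,\dots,i_t)\right\rangle = \left\langle \binom{i_1+\dots+i_t}{i_2+\dots+i_t}\right\rangle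 \left\langle \binom{i_2+\dots+i_t}{i_3+\dots+i_t}\right\rangle\cdots\left\langle \binom{i_{t-1}+i_t}{i_t}\right\rangle.$$ The sum in the claim is the sum of its finitely many nonzero terms. *)

(* Defs.v *)
From mathcomp Require Import all_boot all_order all_algebra.
From mathcomp Require Import all_classical.
From mathcomp Require Import zify.

Set Implicit Arguments.
Unset Strict Implicit.
Unset Printing Implicit Defensive.

Import Order.TTheory GRing.Theory Num.Theory.

Local Open Scope ring_scope.

Definition fibonacci_seq (k : nat) (F : int -> int) : Prop :=
  forall n : int, F n = \sum_(1 <= i < k.+1) F (n - i%:Z).

(* B is the sequence B^(j) of order k; it exists and is unique by
   [basis_fibonacci_exists] and [basis_fibonacci_unique] below. *)
Definition basis_fibonacci (k j : nat) (B : int -> int) : Prop :=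
  fibonacci_seq k B /\ forall i : nat, (i < k)%N -> B i%:Z = (i == j)%:Z.

(* n (n - 1) ... (i + 1) / (n - i)! when i <= n; the integer division is exact
   by [gbin_exact]. *)
Definition gbin (n i : int) : int :=
  if i <= n then
    ((\prod_(m < `|n - i|%N) (n - m%:Z)) %/ (`|n - i|%N)`!%:Z)%Z
  else 0.

(* Entries are indexed from 0, so the i_(l+1) of the usual notation is i l
   here, and [tail_sum i m] is i_(m+1) + ... + i_t. *)
Definition tail_sum (t : nat) (i : {ffun 'I_t -> int}) (m : nat) : int :=
  \sum_(l < t | (m <= l)%N) i l.

Definition gmultinom (t : nat) (i : {ffun 'I_t -> int}) : int :=
  \prod_(m < t.-1) gbin (tail_sum i m) (tail_sum i m.+1).

(* a_1 + 2 a_2 + ... + k a_k *)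
Definition weight (k : nat) (a : {ffun 'I_k -> int}) : int :=
  \sum_(l < k) l.+1%:Z * a l.

Lemma dvdz_fact_prod (n : int) (d : nat) :
  (d`!%:Z %| \prod_(m < d) (n - m%:Z))%Z.
Proof.
case: n => [p|p].
  have [ltpd|ledp] := ltnP p d.
    by rewrite (bigD1 (Ordinal ltpd)) //= subrr mul0r dvdz0.
  have -> : \prod_(m < d) (p%:Z - m%:Z) = (p ^_ d)%:Z.
    rewrite ffact_prod (big_morph Posz PoszM (erefl _)).
    by apply: eq_bigr => m _; have := ltn_ord m; lia.
  by rewrite -bin_ffact PoszM dvdz_mull.
have -> : \prod_(m < d) (Negz p - m%:Z) = (-1) ^+ d * ((p + d) ^_ d)%:Z.
  rewrite ffact_prod (big_morph Posz PoszM (erefl _)).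
  rewrite (reindex_inj rev_ord_inj) -[X in _ ^+ X]card_ord -prodrN.
  by apply: eq_bigr => m _ /=; have := ltn_ord m; lia.
by rewrite -bin_ffact PoszM !dvdz_mull.
Qed.

Lemma gbin_exact (n i : int) : i <= n ->
  gbin n i * (`|n - i|%N)`!%:Z = \prod_(m < `|n - i|%N) (n - m%:Z).
Proof. by move=> le_in; rewrite /gbin le_in divzK // dvdz_fact_prod. Qed.

Lemma fibonacci_seqS (k : nat) (F : int -> int) :
  fibonacci_seq k F <-> forall n : int, F (n + k%:Z) = \sum_(l < k) F (n + l%:Z).
Proof.
have E (n : int) :
    \sum_(1 <= i < k.+1) F (n + k%:Z - i%:Z) = \sum_(l < k) F (n + l%:Z).
  rewrite big_add1 big_mkord /= (reindex_inj rev_ord_inj).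
  by apply: eq_bigr => l _ /=; congr (F _); have := ltn_ord l; lia.
split=> H n; first by rewrite H E.
by have := H (n - k%:Z); rewrite -E !subrK.
Qed.

Lemma basis_fibonacci_exists (k j : nat) : (2 <= k)%N -> (j < k)%N ->
  exists B, basis_fibonacci k j B.
Proof.
case: k => // k lt1k ltjk.
pose fwd (w : nat -> int) i := if (i < k)%N then w i.+1 else \sum_(l < k.+1) w l.
pose bwd (w : nat -> int) i :=
  if i is i'.+1 then w i' else w k - \sum_(l < k) w l.
pose w0 i : int := (i == j)%:Z.
pose W (n : int) := match n with
  | Posz m => iter m fwd w0 | Negz m => iter m.+1 bwd w0 end.
have WS (n : int) : (forall i, (i < k)%N -> W (n + 1) i = W n i.+1)
            /\ W (n + 1) k = \sum_(l < k.+1) W n l.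
  case: n => [m|m].
    have -> : Posz m + 1 = Posz m.+1 by lia.
    by rewrite /= /fwd ltnn; split=> // i ->.
  have -> : W (Negz m) = bwd (W (Negz m + 1)).
    case: m => [|m] //; by have -> : Negz m.+1 + 1 = Negz m by lia.
  by split=> [//|]; rewrite big_ord_recl /= subrK.
have WD (i : nat) (n : int) : (i <= k)%N -> W n i = W (n + i%:Z) 0%N.
  elim: i n => [|i IH] n lik; first by rewrite addr0.
  rewrite -(WS n).1 // IH 1?ltnW //; congr (W _ _); lia.
exists (fun n => W n 0%N); split=> [|i ltik].
  apply/fibonacci_seqS => n.
  have -> : n + k.+1%:Z = (n + 1) + k%:Z by lia.
  rewrite -WD // (WS n).2; apply: eq_bigr => l _.
  by rewrite WD // -ltnS.
by have := @WD i 0 ltik; rewrite add0r => <-.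
Qed.

Lemma basis_fibonacci_unique (k j : nat) (B C : int -> int) : (2 <= k)%N ->
  basis_fibonacci k j B -> basis_fibonacci k j C -> B =1 C.
Proof.
case: k => // k lt1k [/fibonacci_seqS FB B0] [/fibonacci_seqS FC C0].
pose P (n : int) := forall i, (i < k.+1)%N -> B (n + i%:Z) = C (n + i%:Z).
have PS (n : int) : P n -> P (n + 1).
  move=> Pn i; rewrite ltnS leq_eqVlt => /orP[/eqP->|ltik].
    have -> : n + 1 + k%:Z = n + k.+1%:Z by lia.
    by rewrite FB FC; apply: eq_bigr => l _; exact: Pn.
  have -> : n + 1 + i%:Z = n + i.+1%:Z by lia.
  exact: Pn.
have PP (n : int) : P n -> P (n - 1).
  move=> Pn [_|i ltik]; last first.
    have -> : n - 1 + i.+1%:Z = n + i%:Z by lia.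
    by apply: Pn; apply: ltnW.
  have := congr2 (fun x y => x - y) (FB (n - 1)) (FC (n - 1)).
  have -> : n - 1 + k.+1%:Z = n + k%:Z by lia.
  rewrite Pn // subrr -sumrB big_ord_recl /= big1 => [|l _].
    by rewrite addr0 => /esym/eqP; rewrite subr_eq0 => /eqP.
  have -> : n - 1 + (bump 0 l)%:Z = n + l%:Z by rewrite /bump; lia.
  by rewrite Pn ?subrr //; have := ltn_ord l; lia.
have P0 : P 0 by move=> i ltik; rewrite add0r B0 ?C0.
have Pall (n : int) : P n.
  elim: n => // n; first by move=> Pn; rewrite -addn1 PoszD; exact: PS.
  by move=> /PP; have -> : - n%:Z - 1 = - n.+1%:Z by lia.
by move=> n; have := Pall n 0%N isT; rewrite addr0.
Qed.

(* Main.v *)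
Require Import Defs.
From mathcomp Require Import all_boot all_order all_algebra.
From mathcomp Require Import all_classical.
From mathcomp Require Import zify.

Import Order.TTheory GRing.Theory Num.Theory.
Local Open Scope classical_set_scope.
Local Open Scope ring_scope.

(* Write S_m = a_(m+1) + ... + a_k, so that the weight a_1 + 2 a_2 + ... + k a_k
   is S_0 + ... + S_(k-1). The generalized binomials satisfy Pascal's rule without
   exception, hence the multinomial at a is the sum over l of its values at
   a - e_l. As e_l has weight l, the sum over any slab lo <= weight <= hi is the
   sum of its k translates by -1, ..., -k; this is the Fibonacci recurrence. A
   nonzero multinomial forces all S_m >= 0 or all S_m <= -1, so a slab contains
   finitely many nonzero terms, and for weights from -k to -1 the only one is at
   S_0 = ... = S_(k-1) = -1. This gives the initial values for j = 0; those for
   j + 1 follow from D_(j+1)(n) = D_j(n - 1) + D_0(n), where D_j is the claimed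
   sum. *)

(** * Generalized binomials and chained products of them *)

Lemma gbin_nn (n : int) : gbin n n = 1.
Proof. by rewrite /gbin lexx subrr big_ord0 divz1. Qed.

(** For [i < 0 <= n] the product [n (n - 1) ... (i + 1)] runs through the factor 0; the converse is
    just [i <= n]. *)
Lemma gbin_neq0 (n i : int) : gbin n i <> 0 -> (0 <= n) = (0 <= i).
Proof.
move=> nz; have le_in : i <= n by move: nz; rewrite /gbin; case: ifP.
apply/idP/idP => [n0|/le_trans]; last exact.
rewrite leNgt; apply/negP => i0; apply: nz.
have lt_n : (`|n| < `|n - i|)%N by lia.
have := gbin_exact le_in; rewrite [RHS](bigD1 (Ordinal lt_n)) //=.
have -> : n - `|n|%N%:Z = 0 by lia.
rewrite mul0r => /eqP; rewrite mulf_eq0 => /orP[/eqP //|].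
by have := fact_gt0 `|n - i|; lia.
Qed.

(* With d = n - i this is Pascal's rule C(n, d) = C(n - 1, d) + C(n - 1, d - 1)
   for the polynomials C(x, d); it has no exceptional case. *)
Lemma gbin_pascal (n i : int) :
  gbin n i = gbin (n - 1) i + gbin (n - 1) (i - 1).
Proof.
have [lt_ni|le_in] := ltP n i.
  rewrite /gbin !ifF ?addr0 //; lia.
have [->|/eqP ne_in] := eqVneq i n.
  by rewrite !gbin_nn /gbin ifF ?add0r //; lia.
have [d Ed] : exists d : nat, n = i + d.+1%:Z by exists `|(n - i - 1)%R|%N; lia.
subst n; have E1 := gbin_exact le_in.
have le2 : i <= i + d.+1%:Z - 1 by lia.
have le3 : i - 1 <= i + d.+1%:Z - 1 by lia.
have := gbin_exact le2; have := gbin_exact le3; move: E1.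
have -> : (`|(i + d.+1%:Z - i)%R| = d.+1)%N by lia.
have -> : (`|(i + d.+1%:Z - 1 - (i - 1))%R| = d.+1)%N by lia.
have -> : (`|(i + d.+1%:Z - 1 - i)%R| = d)%N by lia.
(* With [n = i + d + 1], the two products of length [d + 1] are [n p] and [p i], and the one of
   length [d] is [p]; Pascal's rule reduces to [n = (d + 1) + i]. *)
rewrite big_ord_recl big_ord_recr /=.
set p := \prod_(m < d) (i + d.+1%:Z - 1 - m%:Z).
have -> : \prod_(m < d) (i + d.+1%:Z - (bump 0 m)%:Z) = p.
  by apply: eq_bigr => m _; rewrite /bump; lia.
move=> E1 E3 E2.
have f0 : (d.+1)`!%:Z != 0 :> int by have := fact_gt0 d.+1; lia.
apply: (mulIf f0); rewrite mulrDl E1 E3 factS PoszM mulrCA E2.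
nia.
Qed.

(** An arbitrary [S] stands in for the tail sums, so that induction on [t] can drop its first
    term. *)
Definition gbin_chain (t : nat) (S : nat -> int) : int :=
  \prod_(m < t) gbin (S m) (S m.+1).

(** Pascal's rule splits the first factor. The term lowering only [S 0] is the case [l = 0]; the
    other lowers [S 1] too, and induction on the remaining chain supplies the cases [l > 0]. *)
Lemma gbin_chain_pascal (t : nat) (S : nat -> int) :
  gbin_chain t S = \sum_(l < t.+1) gbin_chain t (fun m => S m - (m <= l)%N%:Z).
Proof.
elim: t S => [|t IH] S; first by rewrite big_ord1 /gbin_chain !big_ord0.
have chainS T : gbin_chain t.+1 T =
    gbin (T 0%N) (T 1%N) * gbin_chain t (fun m => T m.+1).
  by rewrite /gbin_chain big_ord_recl.
rewrite big_ord_recl chainS gbin_pascal mulrDl; congr (_ + _).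
  rewrite chainS /= subr0; congr (_ * _).
  by apply: eq_bigr => m _; rewrite /= !subr0.
by rewrite IH mulr_sumr; apply: eq_bigr => l _; rewrite chainS.
Qed.

(** * Tail sums, weights and finite supports of multinomials *)

Section Multinomial.
Variable t : nat.
Local Notation k := t.+1.
Implicit Types a : {ffun 'I_k -> int}.

Definition unit_vec (l : 'I_k) : {ffun 'I_k -> int} := [ffun i => (i == l)%:Z].

Lemma tail_sumB_unit a l m :
  tail_sum (a - unit_vec l) m = tail_sum a m - (m <= l)%N%:Z.
Proof.
rewrite /tail_sum; under eq_bigr do rewrite !ffunE.
rewrite sumrB; congr (_ - _); rewrite big_mkcond (bigD1 l) //= eqxx big1 ?addr0.
  by case: ifP.
by move=> i /negPf ->; case: ifP.
Qed.

(** The entry [a l] occurs in the tail sums of index [m <= l], which are [l.+1] in number. *)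
Lemma weight_tail_sum a : weight a = \sum_(m < k) tail_sum a m.
Proof.
rewrite /weight /tail_sum (exchange_big_dep xpredT) //=.
apply: eq_bigr => l _; under eq_bigl do rewrite -ltnS.
by rewrite (big_ord_narrow (ltn_ord l)) sumr_const card_ord -mulr_natl natz.
Qed.

Lemma weightB_unit a l : weight (a - unit_vec l) = weight a - l.+1%:Z.
Proof.
rewrite /weight; under eq_bigr do rewrite !ffunE mulrBr.
rewrite sumrB; congr (_ - _); rewrite (bigD1 l) //= eqxx mulr1 big1 ?addr0 //.
by move=> i /negPf ->; rewrite mulr0.
Qed.

Lemma gmultinom_pascal a : gmultinom a = \sum_l gmultinom (a - unit_vec l).
Proof.
rewrite [LHS](gbin_chain_pascal t (tail_sum a)); apply: eq_bigr => l _.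
by apply: eq_bigr => m _; rewrite !tail_sumB_unit.
Qed.

Lemma gmultinom_tail_sum_sign a : gmultinom a <> 0 ->
  (forall m, (m < k)%N -> 0 <= tail_sum a m) \/
  (forall m, (m < k)%N -> tail_sum a m <= -1).
Proof.
move=> nz; have sg m : (m < k)%N -> (0 <= tail_sum a 0) = (0 <= tail_sum a m).
  elim: m => // m IH lt_mt; rewrite IH 1?ltnW //; apply: gbin_neq0 => g0.
  by apply: nz; rewrite /gmultinom (bigD1 (Ordinal (lt_mt : (m < t)%N))) //= g0 mul0r.
case: (leP 0 (tail_sum a 0)) => S0; [left|right] => m /sg; lia.
Qed.

(** The tail sums share one sign, so nothing cancels when they add up to the weight. *)
Lemma gmultinom_tail_sum_le a m : gmultinom a <> 0 -> (m < k)%N ->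
  `|tail_sum a m| <= `|weight a|.
Proof.
move=> /gmultinom_tail_sum_sign sgn ltmk; rewrite weight_tail_sum.
rewrite (bigD1 (Ordinal ltmk)) //=; set s := \sum_(_ < _ | _) _.
case: sgn => sgn; have := sgn m ltmk.
  by have : 0 <= s by [apply: sumr_ge0 => i _; apply: sgn]; lia.
have : s <= 0 by apply: sumr_le0 => i _; have := sgn i (ltn_ord i); lia.
lia.
Qed.

Lemma tail_sum_max a : tail_sum a k = 0.
Proof. by apply: big_pred0 => l; have := ltn_ord l; lia. Qed.

Lemma tail_sumS a (l : 'I_k) : tail_sum a l = a l + tail_sum a l.+1.
Proof.
rewrite /tail_sum (bigD1 l) //=; congr (_ + _).
by apply: eq_bigl => i; rewrite -val_eqE /=; lia.
Qed.

Lemma finite_box (M : nat) : finite_set [set a : {ffun 'I_k -> int} | forall l, `|a l| <= M%:Z].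
Proof.
pose f (u : {ffun 'I_k -> 'I_(M + M).+1}) : {ffun 'I_k -> int} :=
  [ffun l => (u l)%:Z - M%:Z].
apply: (@sub_finite_set _ _ (f @` setT)); last exact: finite_image.
move=> a /= aM; exists [ffun l => inord `|a l + M%:Z|] => //.
apply/ffunP => l; rewrite !ffunE inordK; move: (aM l); move: (a l) => x; lia.
Qed.

Definition slab (lo hi : int) : set {ffun 'I_k -> int} :=
  [set a | lo <= weight a /\ weight a <= hi].

Lemma finite_slab_gmultinom lo hi :
  finite_set [set a | slab lo hi a /\ gmultinom a <> 0].
Proof.
pose M := (`|lo| + `|hi|)%N.
apply: sub_finite_set (finite_box (M + M)) => a [[lea gea] nz] l.
have wM : `|weight a| <= M%:Z by lia.
(* An entry is the difference of two consecutive tail sums, each bounded by [M]; hence the box of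
   size [M + M]. *)
have := gmultinom_tail_sum_le a l nz (ltn_ord l); rewrite tail_sumS.
have : `|tail_sum a l.+1| <= M%:Z.
  have [ltlk|] := ltnP l.+1 k.
    by apply: le_trans wM; apply: gmultinom_tail_sum_le.
  by move=> lekl; have -> : l.+1 = k by [have := ltn_ord l; lia]; rewrite tail_sum_max.
lia.
Qed.

End Multinomial.

(** Both sides restrict to the finite union [X] of the supports of the [f l] in [P], where finite
    sums can be exchanged. *)
Lemma exchange_fsum_ord (I : choiceType) (V : nmodType) (m : nat) (P : set I)
    (f : 'I_m -> I -> V) :
    (forall l, finite_set (P `&` f l @^-1` [set~ 0])) ->
  \sum_(x \in P) \sum_l f l x = \sum_l \sum_(x \in P) f l x.
Proof.
move=> fin; pose X := \bigcup_(l in [set: 'I_m]) (P `&` f l @^-1` [set~ 0]).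
have finX : finite_set X by apply: bigcup_finite.
have XP : X `<=` P by move=> x [l _ []].
have fX l x : P x -> ~ X x -> f l x = 0.
  by move=> Px nXx; apply/eqP/negPn/negP => /eqP nz; apply: nXx; exists l.
rewrite -(@fsbig_widen _ _ _ _ X) => //; last first.
  by move=> x [Px nXx]; rewrite /= big1 // => l _; exact: fX.
rewrite fsbig_finite // exchange_big; apply: eq_bigr => l _.
by rewrite -fsbig_finite //; apply: fsbig_widen => // x [Px /fX]; exact.
Qed.

(** * Sums over slabs of weights *)

Section SlabSum.
Variable t : nat.
Local Notation k := t.+1.

Definition slab_sum (lo hi : int) : int :=
  \sum_(a \in slab t lo hi) gmultinom a.

Lemma slab_sum_rec lo hi :
  slab_sum lo hi = \sum_(l < k) slab_sum (lo - l.+1%:Z) (hi - l.+1%:Z).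
Proof.
have bij (l : 'I_k) : set_bij (slab t lo hi)
    (slab t (lo - l.+1%:Z) (hi - l.+1%:Z)) (fun a => a - unit_vec t l).
  split=> [a [lea gea]|a b _ _ /addIr //|a [lea gea]].
    by rewrite /slab /= weightB_unit; lia.
  exists (a + unit_vec t l); last by rewrite addrK.
  by have := weightB_unit t (a + unit_vec t l) l; rewrite addrK /slab /=; lia.
rewrite /slab_sum; under eq_fsbigr do rewrite gmultinom_pascal.
rewrite exchange_fsum_ord => [|l].
  by apply: eq_bigr => l _; rewrite (reindex_fsbig _ _ _ _ (bij l)).
(* The support of the [l]-th summand lies in a translate of a support known to be finite. *)
have fin := finite_slab_gmultinom t (lo - l.+1%:Z) (hi - l.+1%:Z).
apply: sub_finite_set (finite_image (fun a => a + unit_vec t l) fin).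
move=> a [Pa nz]; exists (a - unit_vec t l); last by rewrite subrK.
by split=> //; apply: (set_bij_sub (bij l)); exists a.
Qed.

Lemma slab_sum_cat (lo mid hi : int) : lo <= mid + 1 -> mid <= hi ->
  slab_sum lo hi = slab_sum lo mid + slab_sum (mid + 1) hi.
Proof.
move=> le1 le2; have fin x y :
    finite_set (slab t x y `&` @gmultinom t.+1 @^-1` [set~ 0 : int]).
  exact: finite_slab_gmultinom.
(* [fsbigU0] asks for finite index sets, so the slabs are first cut down to supports. *)
rewrite /slab_sum !(fsbig_supp _ (slab t _ _)) -fsbigU0 //.
  apply: eq_fsbigl; rewrite -setIUl; congr (_ `&` _).
  apply/seteqP; split=> a; rewrite /slab /=; lia.
by move=> a [[[]] + + _ [[]]]; lia.
Qed.

Lemma slab_sum_diag (w : int) : - k%:Z <= w -> w < 0 ->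
  slab_sum w w = (w == - k%:Z)%:Z.
Proof.
(* [a0 = (0, ..., 0, -1)] is the vector whose tail sums of index below [k] are all -1. *)
move=> ge_w lt_w; pose a0 := - unit_vec t ord_max.
have tail0 m : (m < k)%N -> tail_sum a0 m = -1.
  move=> lt_mk; rewrite /a0 -[- _]sub0r tail_sumB_unit.
  rewrite /tail_sum big1 => [|i _]; last by rewrite ffunE.
  by rewrite (_ : (m <= _)%N = true) //=; lia.
have gm0 : gmultinom a0 = 1.
  rewrite /gmultinom big1 // => m _; rewrite !tail0 ?gbin_nn //;
    have := ltn_ord m; lia.
have wt0 : weight a0 = - k%:Z.
  rewrite weight_tail_sum; under eq_bigr do rewrite tail0 ?ltn_ord //.
  by rewrite sumr_const card_ord mulNrn natz.
have only_a0 a : weight a = w -> gmultinom a <> 0 -> a = a0.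
  move=> wa /gmultinom_tail_sum_sign[S0|SN1].
    suff : 0 <= weight a by lia.
    by rewrite weight_tail_sum; apply: sumr_ge0 => i _; apply: S0.
  (* The numbers [-1 - S_m] are nonnegative with sum [-k - w <= 0], so each is 0. *)
  have pos (i : 'I_k) : true -> 0 <= - 1 - tail_sum a i.
    by move=> _; have := SN1 i (ltn_ord i); lia.
  have sum0 : \sum_(i < k) (- 1 - tail_sum a i) = 0.
    apply/eqP; rewrite eq_le sumr_ge0 // andbT sumrB -weight_tail_sum wa.
    by rewrite sumr_const card_ord mulNrn natz; lia.
  have tail m : (m < k)%N -> tail_sum a m = -1.
    move=> lt_mk; have /(_ (Ordinal lt_mk) isT) /= := psumr_eq0P pos sum0; lia.
  apply/ffunP => l; have := tail_sumS t a l; have := tail_sumS t a0 l.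
  have -> : tail_sum a l.+1 = tail_sum a0 l.+1.
    have [lt_lk|le_kl] := ltnP l.+1 k; first by rewrite tail0 // tail.
    have -> : l.+1 = k by have := ltn_ord l; lia.
    by rewrite !tail_sum_max.
  by rewrite tail0 // tail // => -> /addIr ->.
have [wk|ne_w] := eqVneq w (- k%:Z).
  rewrite /slab_sum -(@fsbig_widen _ _ _ _ [set a0]) ?fsbig_set1 //.
    by move=> a ->; rewrite /slab /= wt0 wk.
  move=> a [[lea gea] nea]; apply: contrapT => nz; apply: nea.
  by apply: only_a0 => //; lia.
rewrite /slab_sum fsbig1 // => a [lea gea]; apply: contrapT => nz.
have wa : weight a = w by lia.
by case/eqP: ne_w; rewrite -wa (only_a0 a wa nz).
Qed.

End SlabSum.

(** * Initial values of the slab sums *)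

Lemma slab_sum_basis (t j : nat) : (j < t.+1)%N ->
  basis_fibonacci t.+1 j
    (fun n => slab_sum t (n - t.+1%:Z - j%:Z) (n - t.+1%:Z)).
Proof.
have fib i : fibonacci_seq t.+1
    (fun n => slab_sum t (n - t.+1%:Z - i%:Z) (n - t.+1%:Z)).
  move=> n; rewrite slab_sum_rec big_add1 big_mkord; apply: eq_bigr => l _.
  by move: (nat_of_ord l) => p; congr slab_sum; lia.
have diag (n : nat) : (n < t.+1)%N ->
    slab_sum t (n%:Z - t.+1%:Z) (n%:Z - t.+1%:Z) = (n == 0%N)%:Z.
  move=> ltn; rewrite slab_sum_diag; [congr (nat_of_bool _)%:Z| |]; lia.
elim: j => [|j IH] ltj; split=> // n ltn; first by rewrite subr0 diag.
rewrite (slab_sum_cat _ _ (n%:Z - t.+1%:Z - 1)); try lia.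
rewrite subrK diag //; have [_ init] := IH (ltnW ltj).
case: n ltn => [|n] ltn; last first.
  have := init n (ltnW ltn); rewrite addr0 eqSS => <-.
  by congr slab_sum; lia.
(* For [n = 0] the value D_j(-1) lies outside the initial window. The recurrence gives D_j(k-1) =
   D_j(-1) + D_j(0) + ... + D_j(k-2); as [j <= k - 2], this reads 0 = D_j(-1) + 1, and D_j(-1)
   cancels D_0(0) = 1. *)
have /fibonacci_seqS/(_ (-1)) := fib j; rewrite big_ord_recl.
have -> : -1 + t.+1%:Z = t%:Z by lia.
rewrite init // (eq_bigr (fun l : 'I_t => (l == j :> nat)%:Z)) => [|l _]; last first.
  rewrite -init; last by have := ltn_ord l; lia.
  by rewrite lift0; move: (nat_of_ord l) => p; congr slab_sum; lia.
rewrite (bigD1 (Ordinal (ltj : (j < t)%N))) //= eqxx big1 => [|l]; last first.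
  by rewrite -val_eqE /= => /negPf ->.
have -> : (t == j) = false by lia.
have -> : 0 - t.+1%:Z - j.+1%:Z = -1 + 0 - t.+1%:Z - j%:Z by lia.
have -> : 0 - t.+1%:Z - 1 = -1 + 0 - t.+1%:Z by lia.
by rewrite addr0 => ->.
Qed.

Theorem theorem12 (k : nat) (hk : (2 <= k)%N) (j : nat) (hj : (j <= k.-1)%N)
    (B : int -> int) (hB : basis_fibonacci k j B) (n : int) :
  let A := [set a : {ffun 'I_k -> int} |
              n - k%:Z - j%:Z <= weight a /\ weight a <= n - k%:Z] in
  finite_set [set a | A a /\ gmultinom a <> 0] /\
  B n = \sum_(a \in A) gmultinom a.
Proof.
case: k hk hj hB => // t hk hj hB; split; first exact: finite_slab_gmultinom.
exact: (basis_fibonacci_unique hk hB (slab_sum_basis t j hj)).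
Qed.
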